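(* Let $n\ge 5$ be an odd integer with $3\nmid n$. For every $a\in(\mathbb{Z}_n)^3$ one has $\mu(a)\in\{0,1,2,3,4,13\}$. Writing $M_k(n)=\#\{a\in(\mathbb{Z}_n)^3:\mu(a)=k\}$, one has $$M_{13}(n)=1,\quad M_4(n)=9(n-1),\quad M_3(n)=4(n-1),\quad M_2(n)=12(n-1),$$ $$M_1(n)=13n^2-72n+59,\qquad M_0(n)=n^3-13n^2+47n-35 .$$ Equivalently, the adjacency eigenvalues of the toroidal 3D queen graph $G_n$ are $\lambda_k=kn-13$ for $k\in\{0,1,2,3,4,13\}$, with $\lambda_k$ having multiplicity $M_k(n)$ (where multiplicity $0$ means that the value does not occur as an eigenvalue). For $n=5$ and $n=7$ one has $M_0(n)=0$; for every odd $n>7$ with $3\nmid n$, all six multiplicities $M_0(n),M_1(n),M_2(n),M_3(n),M_4(n),M_{13}(n)$ are positive.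
   Context: $\mathbb{Z}_n=\mathbb{Z}/n\mathbb{Z}$. Let $U$ be the set of the 13 integer vectors $$(1,0,0),(0,1,0),(0,0,1),(1,1,0),(1,-1,0),(1,0,1),(1,0,-1),(0,1,1),(0,1,-1),(1,1,1),(1,1,-1),(1,-1,1),(1,-1,-1),$$ one representative from each opposite pair in $\{-1,0,1\}^3\setminus\{0\}$. For $n$ odd with $3\nmid n$, the toroidal 3D queen graph $G_n$ is the simple undirected graph with vertex set $(\mathbb{Z}_n)^3$ in which two distinct vertices $x,y$ are adjacent if $y=x+tu$ in $(\mathbb{Z}_n)^3$ for some $u\in U$ and some $t\in\{1,\dots,n-1\}$. The dot product is $a\cdot u=a_1u_1+a_2u_2+a_3u_3$ modulo $n$. The orthogonality count of $a\in(\mathbb{Z}_n)^3$ is $\mu(a)=\#\{u\in U: a\cdot u\equiv 0 \pmod n\}$. Adjacency eigenvalues are the eigenvalues of the adjacency matrix of $G_n$, counted with multiplicity. *)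

(* Defs.v *)
From HB Require Import structures.
From mathcomp Require Import all_boot all_order all_algebra.

Set Implicit Arguments.
Unset Strict Implicit.
Unset Printing Implicit Defensive.

Import Order.TTheory GRing.Theory Num.Theory.
Local Open Scope ring_scope.

Definition vec3 (x y z : int) : 'rV[int]_3 := \row_(i < 3) [:: x; y; z]`_i.

Definition queen_dirs : seq 'rV[int]_3 :=
  [:: vec3 1 0 0; vec3 0 1 0; vec3 0 0 1;
      vec3 1 1 0; vec3 1 (-1) 0; vec3 1 0 1; vec3 1 0 (-1);
      vec3 0 1 1; vec3 0 1 (-1);
      vec3 1 1 1; vec3 1 1 (-1); vec3 1 (-1) 1; vec3 1 (-1) (-1)].

(* 'Z_n is the ring of integers mod n only for 1 < n. *)
Notation torus n := 'rV['Z_n]_3.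

Definition dot (n : nat) (a : torus n) (u : 'rV[int]_3) : 'Z_n :=
  \sum_(i < 3) a 0 i * (u 0 i)%:~R.

(* queen_dirs has no repeated entry (queen_dirs_uniq), so counting in the
   list counts in the set of directions. *)
Definition orth_count (n : nat) (a : torus n) : nat :=
  count (fun u => dot a u == 0) queen_dirs.

Definition orth_mult (n k : nat) : nat :=
  #|[set a : torus n | orth_count a == k]|.

Definition queen_adj (n : nat) : rel (torus n) := fun x y =>
  (x != y) &&
  has (fun u => [exists t : 'I_n,
         (0 < t)%N && (y == x + (t : nat)%:R *: map_mx intr u)])
      queen_dirs.

(* Rows and columns are indexed by 'I_#|V| through the enumeration of the
   vertex set V. *)
Definition queen_mx (R : pzSemiRingType) (n : nat) : 'M[R]_#|{: torus n}| :=
  \matrix_(i, j) (queen_adj (enum_val i) (enum_val j))%:R.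

Definition orth_values : seq nat := [:: 0; 1; 2; 3; 4; 13]%N.

Definition queen_eig (R : pzRingType) (n k : nat) : R := (k * n)%:R - 13%:R.

Lemma vec3_inj x y z x' y' z' :
  (vec3 x y z == vec3 x' y' z') = [&& x == x', y == y' & z == z'].
Proof.
apply/eqP/and3P => [E|[/eqP-> /eqP-> /eqP->]] //.
have H i := congr1 (fun M : 'rV[int]_3 => M 0 i) E.
by split; apply/eqP; [move: (H 0) | move: (H 1) | move: (H 2%:R)]; rewrite !mxE.
Qed.

Lemma queen_dirs_uniq : uniq queen_dirs.
Proof. by rewrite /= !inE !vec3_inj. Qed.

Lemma queen_adj_irr (n : nat) : irreflexive (@queen_adj n).
Proof. by move=> x; rewrite /queen_adj eqxx. Qed.

Lemma queen_adj_sym (n : nat) : (1 < n)%N -> symmetric (@queen_adj n).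
Proof.
move=> n1.
suff H x y : queen_adj x y -> queen_adj (n := n) y x.
  by move=> x y; apply/idP/idP; apply: H.
case/andP=> neq_xy /hasP[u Uu /existsP[t /andP[t_gt0 /eqP Ey]]].
rewrite /queen_adj eq_sym neq_xy; apply/hasP; exists u => //.
have lt_nt : (n - t < n)%N by rewrite ltn_subrL t_gt0 ltnW.
apply/existsP; exists (Ordinal lt_nt); rewrite /= subn_gt0 ltn_ord /=.
by rewrite Ey -addrA -scalerDl -natrD subnKC 1?ltnW // pchar_Zp // scale0r addr0.
Qed.

(* Main.v *)
(* If a is orthogonal to two distinct directions u, w, then a is parallel to
   their cross product.  Up to units of Z_n (n is prime to 6) these cross
   products run over 25 axes: the 13 directions and the 12 vectors of type
   (1,1,2).  The lines spanned by the axes meet only at 0, and the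
   orthogonality count is constant on a punctured line, which gives M_2, M_3,
   M_4 and M_13.  The characters of Z_n^3 diagonalise the adjacency matrix with
   eigenvalues n mu(a) - 13; its trace is 0, so the counts mu(a) sum to 13 n^2,
   and this determines M_1, hence M_0. *)
Require Import Defs.
From HB Require Import structures.
From mathcomp Require Import all_boot all_order all_algebra all_field.
From mathcomp Require Import ring zify.

Set Implicit Arguments.
Unset Strict Implicit.
Unset Printing Implicit Defensive.

Import Order.TTheory GRing.Theory Num.Theory.
Local Open Scope ring_scope.

(** * Integer directions and axes, with finite checks by computation *)

Definition ivec : Type := (int * int * int)%type.

Definition vec (v : ivec) : 'rV[int]_3 := vec3 v.1.1 v.1.2 v.2.

Definition idot (v w : ivec) : int :=
  v.1.1 * w.1.1 + v.1.2 * w.1.2 + v.2 * w.2.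

Definition icross (v w : ivec) : ivec :=
  (v.1.2 * w.2 - v.2 * w.1.2, v.2 * w.1.1 - v.1.1 * w.2,
   v.1.1 * w.1.2 - v.1.2 * w.1.1).

Definition iscale (c : int) (v : ivec) : ivec := (c * v.1.1, c * v.1.2, c * v.2).

Definition entries (v : ivec) : seq int := [:: v.1.1; v.1.2; v.2].

(** Plain integer triples, unlike matrices, let the finite checks below run by [vm_compute]. *)
Definition dirs : seq ivec :=
  [:: (1, 0, 0); (0, 1, 0); (0, 0, 1);
      (1, 1, 0); (1, -1, 0); (1, 0, 1); (1, 0, -1); (0, 1, 1); (0, 1, -1);
      (1, 1, 1); (1, 1, -1); (1, -1, 1); (1, -1, -1)].

(** The signs are chosen so that every axis has an entry equal to 1, from which the parameter of a
    point on its line can be read off. *)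
Definition axes : seq ivec := dirs ++
  [:: (1, 1, 2%:Z); (1, 1, - 2%:Z); (1, -1, 2%:Z); (1, -1, - 2%:Z);
      (1, 2%:Z, 1); (1, - 2%:Z, 1); (1, 2%:Z, -1); (1, - 2%:Z, -1);
      (2%:Z, 1, 1); (- 2%:Z, 1, 1); (2%:Z, 1, -1); (- 2%:Z, 1, -1)].

(** These are the nonzero integers of absolute value at most 4. Their only prime factors are 2 and
    3, so they are units modulo n when n is prime to 6. *)
Definition small : seq int :=
  [:: 1; 2%:Z; 3%:Z; 4%:Z; -1; - 2%:Z; - 3%:Z; - 4%:Z].

Definition axis_count (v : ivec) : nat := count (fun u => idot v u == 0) dirs.

Lemma queen_dirsE : queen_dirs = map vec dirs.
Proof. by []. Qed.

(** Makes orthogonality of an axis and a direction modulo n equivalent to orthogonality over the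
    integers. *)
Lemma axes_dot_small :
  all (fun v => all (fun u => (idot v u == 0) || (idot v u \in small)) dirs) axes.
Proof. by vm_compute. Qed.

Lemma axes_entry1 : all (fun v => 1 \in entries v) axes.
Proof. by vm_compute. Qed.

(** A unit component in the cross product keeps the lines of two distinct axes apart modulo n. *)
Lemma axes_cross_small :
  all (fun v => all (fun w =>
    (v == w) || has (mem small) (entries (icross v w))) axes) axes.
Proof. by vm_compute. Qed.

(** The factors 2 and -2 do occur: (1,1,0) x (1,-1,0) = (0,0,-2). *)
Lemma dirs_cross_axes :
  all (fun u => all (fun w => (u == w) ||
    has (fun v => has (fun c => icross u w == iscale c v)
                      [:: 1; -1; 2%:Z; - 2%:Z]) axes) dirs) dirs.
Proof. by vm_compute. Qed.

Lemma axes_uniq : uniq axes.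
Proof. by vm_compute. Qed.

Lemma axis_count_values : all (fun v => axis_count v \in [:: 2; 3; 4]%N) axes.
Proof. by vm_compute. Qed.

(** * Axes reduced modulo n and their orthogonality counts *)

Definition tvec (n : nat) (v : ivec) : 'rV['Z_n]_3 := map_mx intr (vec v).

Lemma big_ord3 (R : nmodType) (F : 'I_3 -> R) :
  \sum_(i < 3) F i = F 0 + F 1 + F 2%:R.
Proof.
rewrite !big_ord_recl big_ord0 addr0 addrA.
by congr (F _ + F _ + F _); apply/val_inj.
Qed.

Lemma row3P (T : Type) (x y : 'rV[T]_3) :
  x 0 0 = y 0 0 -> x 0 1 = y 0 1 -> x 0 2%:R = y 0 2%:R -> x = y.
Proof.
move=> E0 E1 E2; apply/rowP => -[[|[|[|//]]] lti].
- by rewrite (_ : Ordinal _ = 0) //; apply/val_inj.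
- by rewrite (_ : Ordinal _ = 1) //; apply/val_inj.
- by rewrite (_ : Ordinal _ = 2%:R) //; apply/val_inj.
Qed.

Lemma scale_tvecE (n : nat) (t : 'Z_n) (v : ivec) :
  ((t *: tvec n v) 0 0 = t * v.1.1%:~R) * ((t *: tvec n v) 0 1 = t * v.1.2%:~R)
  * ((t *: tvec n v) 0 2%:R = t * v.2%:~R).
Proof. by rewrite !mxE. Qed.

Lemma dot_vec (n : nat) (a : 'rV['Z_n]_3) (u : ivec) :
  dot a (vec u) = a 0 0 * u.1.1%:~R + a 0 1 * u.1.2%:~R + a 0 2%:R * u.2%:~R.
Proof. by rewrite /dot big_ord3 !mxE. Qed.

Lemma dot_axis (n : nat) (t : 'Z_n) (v u : ivec) :
  dot (t *: tvec n v) (vec u) = t * (idot v u)%:~R.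
Proof. by rewrite dot_vec !scale_tvecE /idot; ring. Qed.

Lemma small_unit (n : nat) (c : int) : (1 < n)%N -> odd n -> ~~ (3 %| n)%N ->
  c \in small -> (c%:~R : 'Z_n) \is a GRing.unit.
Proof.
move=> n1 n_odd n3.
have c2 : coprime n 2 by rewrite coprimen2.
have c3 : coprime n 3 by rewrite coprime_sym prime_coprime.
have c4 : coprime n 4 by rewrite (coprimeMr n 2 2) c2.
by rewrite !inE => /or4P[|||/or4P[|||/orP[]]] => /eqP->;
   rewrite ?rmorphN /= ?unitrN ?unitr1 //; rewrite -pmulrn unitZpE.
Qed.

Lemma small_eq0 (n : nat) (c : int) (t : 'Z_n) :
  (1 < n)%N -> odd n -> ~~ (3 %| n)%N ->
  c \in small -> (t * c%:~R == 0) = (t == 0).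
Proof.
move=> n1 n_odd n3 /(small_unit n1 n_odd n3) Uc.
by apply/eqP/eqP => [E|->]; [rewrite -(mulrK Uc t) E mul0r | rewrite mul0r].
Qed.

(** The scalar t may be a zero divisor: the dot products are t c with c zero or a unit, and t c = 0
    with t nonzero forces c = 0. *)
Lemma orth_count_axis (n : nat) (v : ivec) (t : 'Z_n) :
  (1 < n)%N -> odd n -> ~~ (3 %| n)%N -> v \in axes -> t != 0 ->
  orth_count (t *: tvec n v) = axis_count v.
Proof.
move=> n1 n_odd n3 Dv t0; rewrite /orth_count queen_dirsE count_map.
apply: eq_in_count => u Du; rewrite /= dot_axis.
have /orP[/eqP->|Su] := allP (allP axes_dot_small v Dv) u Du.
  by rewrite mulr0 !eqxx.
rewrite small_eq0 // (negbTE t0); apply/esym/eqP => E0.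
by rewrite E0 in Su.
Qed.

(** * Punctured lines of the axes, and vectors orthogonal to two directions *)

Definition lines (n : nat) (V : seq ivec) : seq 'rV['Z_n]_3 :=
  [seq t *: tvec n v | v <- V, t <- [seq t : 'Z_n <- enum 'Z_n | t != 0]].

Lemma size_nonzero (n : nat) : (1 < n)%N ->
  size [seq t : 'Z_n <- enum 'Z_n | t != 0] = n.-1.
Proof.
move=> n1; rewrite size_filter.
have := count_predC (fun t : 'Z_n => t == 0) (enum 'Z_n).
rewrite (count_uniq_mem _ (enum_uniq _)) mem_enum -cardE card_ord.
by rewrite add1n => -[->]; rewrite -{2}(Zp_cast n1).
Qed.

(** From t v = s w follows t (v x w) = s (w x w) = 0, taken componentwise. *)
Lemma cross_axis (n : nat) (t s : 'Z_n) (v w : ivec) (c : int) :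
  t *: tvec n v = s *: tvec n w -> c \in entries (icross v w) -> t * c%:~R = 0.
Proof.
move=> E; have E_ i := congr1 (fun x : 'rV['Z_n]_3 => x 0 i) E.
move: (E_ 0) (E_ 1) (E_ 2%:R).
rewrite !scale_tvecE => E0 E1 E2.
rewrite !inE /= => /or3P[] /eqP->; rewrite rmorphB !rmorphM /=.
- transitivity (t * v.1.2%:~R * w.2%:~R - t * v.2%:~R * w.1.2%:~R); first by ring.
  by rewrite E1 E2; ring.
- transitivity (t * v.2%:~R * w.1.1%:~R - t * v.1.1%:~R * w.2%:~R); first by ring.
  by rewrite E0 E2; ring.
- transitivity (t * v.1.1%:~R * w.1.2%:~R - t * v.1.2%:~R * w.1.1%:~R); first by ring.
  by rewrite E0 E1; ring.
Qed.

(** For distinct axes some unit c would satisfy t c = 0, against t nonzero. For equal axes, the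
    entry 1 yields t = s. *)
Lemma axis_inj (n : nat) (v w : ivec) (t s : 'Z_n) :
  (1 < n)%N -> odd n -> ~~ (3 %| n)%N -> v \in axes -> w \in axes -> t != 0 ->
  t *: tvec n v = s *: tvec n w -> v = w /\ t = s.
Proof.
move=> n1 n_odd n3 Dv Dw t0 E.
have /orP[/eqP Evw|/hasP[c Wc Sc]] := allP (allP axes_cross_small v Dv) w Dw.
  split=> //; subst w; have E_ i := congr1 (fun x : 'rV['Z_n]_3 => x 0 i) E.
  move: (E_ 0) (E_ 1) (E_ 2%:R); rewrite !scale_tvecE.
  have := allP axes_entry1 v Dv.
  by rewrite !inE => /or3P[] /eqP<-; rewrite !mulr1.
have := cross_axis E Wc; move/eqP; rewrite small_eq0 //.
by rewrite (negbTE t0).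
Qed.

Lemma lines_uniq (n : nat) (V : seq ivec) :
  (1 < n)%N -> odd n -> ~~ (3 %| n)%N -> uniq V -> {subset V <= axes} ->
  uniq (lines n V).
Proof.
move=> n1 n_odd n3 UV sV; apply: allpairs_uniq => //.
  by rewrite filter_uniq ?enum_uniq.
move=> /= [v t] [w s] /allpairsP[[v' t'] /= [Vv Ft [-> ->]]].
move=> /allpairsP[[w' s'] /= [Vw _ [-> ->]]] E.
move: Ft; rewrite mem_filter => /andP[t0 _].
by have [] := axis_inj n1 n_odd n3 (sV _ Vv) (sV _ Vw) t0 E => -> ->.
Qed.

Lemma linesP (n : nat) (V : seq ivec) (a : 'rV['Z_n]_3) :
  reflect (exists v t, [/\ v \in V, t != 0 & a = t *: tvec n v])
          (a \in lines n V).
Proof.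
apply: (iffP allpairsP) => [[[v t] /= [Vv]]|[v [t [Vv t0 ->]]]].
  by rewrite mem_filter => /andP[t0 _] ->; exists v, t.
by exists (v, t); rewrite /= mem_filter t0 mem_enum.
Qed.

(* For cross products, a x (u x w) = (a.w) u - (a.u) w = 0, so a is parallel
   to u x w, a unit multiple of an axis. *)
Lemma orth2_axis (n : nat) (a : 'rV['Z_n]_3) (u w : ivec) :
  (1 < n)%N -> odd n -> ~~ (3 %| n)%N -> u \in dirs -> w \in dirs -> u != w ->
  dot a (vec u) = 0 -> dot a (vec w) = 0 ->
  exists v t, v \in axes /\ a = t *: tvec n v.
Proof.
move=> n1 n_odd n3 Du Dw neq_uw; rewrite !dot_vec => au aw.
have := allP (allP dirs_cross_axes u Du) w Dw; rewrite (negbTE neq_uw) orFb.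
case/hasP=> v Dv /hasP[c Sc /eqP]; rewrite /icross /iscale => -[E0 E1 E2].
have Uc : (c%:~R : 'Z_n) \is a GRing.unit.
  by apply: small_unit => //; move: Sc; rewrite !inE => /or4P[] /eqP->.
have canc (x : 'Z_n) : c%:~R * x = 0 -> x = 0.
  by move=> E; rewrite -(mulKr Uc x) E mulr0.
(* The next three equations express a x v = 0. Multiplied by the unit c, each becomes, up to sign, a
   component of (a.w) u - (a.u) w. *)
have P01 : a 0 0 * v.1.2%:~R = a 0 1 * v.1.1%:~R.
  apply/eqP; rewrite -subr_eq0; apply/eqP/canc.
  transitivity (a 0 0 * (c * v.1.2)%:~R - a 0 1 * (c * v.1.1)%:~R); first by ring.
  rewrite -E1 -E0.
  transitivity (u.2%:~R * (a 0 0 * w.1.1%:~R + a 0 1 * w.1.2%:~R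
      + a 0 2%:R * w.2%:~R)
    - w.2%:~R * (a 0 0 * u.1.1%:~R + a 0 1 * u.1.2%:~R + a 0 2%:R * u.2%:~R)).
    by ring.
  by rewrite au aw !mulr0 subr0.
have P02 : a 0 0 * v.2%:~R = a 0 2%:R * v.1.1%:~R.
  apply/eqP; rewrite -subr_eq0; apply/eqP/canc.
  transitivity (a 0 0 * (c * v.2)%:~R - a 0 2%:R * (c * v.1.1)%:~R); first by ring.
  rewrite -E2 -E0.
  transitivity (w.1.2%:~R * (a 0 0 * u.1.1%:~R + a 0 1 * u.1.2%:~R
      + a 0 2%:R * u.2%:~R)
    - u.1.2%:~R * (a 0 0 * w.1.1%:~R + a 0 1 * w.1.2%:~R + a 0 2%:R * w.2%:~R)).
    by ring.
  by rewrite au aw !mulr0 subr0.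
have P12 : a 0 1 * v.2%:~R = a 0 2%:R * v.1.2%:~R.
  apply/eqP; rewrite -subr_eq0; apply/eqP/canc.
  transitivity (a 0 1 * (c * v.2)%:~R - a 0 2%:R * (c * v.1.2)%:~R); first by ring.
  rewrite -E2 -E1.
  transitivity (u.1.1%:~R * (a 0 0 * w.1.1%:~R + a 0 1 * w.1.2%:~R
      + a 0 2%:R * w.2%:~R)
    - w.1.1%:~R * (a 0 0 * u.1.1%:~R + a 0 1 * u.1.2%:~R + a 0 2%:R * u.2%:~R)).
    by ring.
  by rewrite au aw !mulr0 subr0.
(* At a position where v has entry 1, the coordinate of a is the scalar t with a = t v. *)
have := allP axes_entry1 v Dv; rewrite !inE => /or3P[] /eqP v1.
- by exists v, (a 0 0); split=> //; apply: row3P;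
     rewrite !scale_tvecE ?P01 ?P02 -v1 mulr1.
- by exists v, (a 0 1); split=> //; apply: row3P;
     rewrite !scale_tvecE -?P01 ?P12 -v1 mulr1.
- by exists v, (a 0 2%:R); split=> //; apply: row3P;
     rewrite !scale_tvecE -?P02 -?P12 -v1 mulr1.
Qed.

Lemma size_lines (n : nat) (V : seq ivec) : (1 < n)%N ->
  size (lines n V) = (size V * n.-1)%N.
Proof. by move=> n1; rewrite size_allpairs size_nonzero. Qed.

(** * Values of the orthogonality count and the multiplicities of 2, 3, 4 and 13 *)

Lemma orth_count0 (n : nat) : orth_count (0 : 'rV['Z_n]_3) = 13%N.
Proof.
rewrite /orth_count (eq_count (a2 := predT)) ?count_predT // => u.
by rewrite /= /dot big1 ?eqxx // => i _; rewrite mxE mul0r.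
Qed.

Lemma orth_count_ge2 (n : nat) (a : 'rV['Z_n]_3) :
  (1 < n)%N -> odd n -> ~~ (3 %| n)%N -> (1 < orth_count a)%N -> a != 0 ->
  exists v t, [/\ v \in axes, t != 0 & a = t *: tvec n v].
Proof.
move=> n1 n_odd n3;
  rewrite /orth_count queen_dirsE count_map -size_filter => mu2 a0.
set s := filter _ _ in mu2.
have Us : uniq s by apply: filter_uniq.
have Ss u : u \in s -> u \in dirs /\ dot a (vec u) = 0.
  by rewrite mem_filter => /andP[/eqP].
(* The list of directions orthogonal to a has no repetition, so its first two entries are
   distinct. *)
case: s mu2 Us Ss => [|u [|w s]] //= _ /and3P[]; rewrite inE negb_or.
move=> /andP[neq_uw _] _ _ Ss.
have [|Du au] := Ss u; first by rewrite mem_head.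
have [|Dw aw] := Ss w; first by rewrite !inE eqxx orbT.
have [v [t [Dv Ea]]] := orth2_axis n1 n_odd n3 Du Dw neq_uw au aw.
by exists v, t; split=> //; apply: contraNneq a0 => t0; rewrite Ea t0 scale0r.
Qed.

Lemma orth_count_range (n : nat) (a : 'rV['Z_n]_3) :
  (1 < n)%N -> odd n -> ~~ (3 %| n)%N -> orth_count a \in orth_values.
Proof.
move=> n1 n_odd n3; have [->|a0] := eqVneq a 0; first by rewrite orth_count0.
have [|mu2] := leqP (orth_count a) 1; first by case: (orth_count a) => [|[|]].
have [v [t [Dv t0 ->]]] := orth_count_ge2 n1 n_odd n3 mu2 a0.
rewrite orth_count_axis //; have := allP axis_count_values v Dv.
by rewrite !inE => /or3P[] /eqP->.
Qed.

(** The vectors counted form the disjoint union of the punctured lines of the axes with count k,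
    each with n - 1 points. *)
Lemma orth_mult_axes (n k : nat) :
  (1 < n)%N -> odd n -> ~~ (3 %| n)%N -> k \in [:: 2; 3; 4]%N ->
  orth_mult n k = (count (fun v => axis_count v == k) axes * n.-1)%N.
Proof.
move=> n1 n_odd n3 Sk; rewrite -size_filter.
have sV v : v \in [seq v <- axes | axis_count v == k] =
            (axis_count v == k) && (v \in axes) by rewrite mem_filter.
have UV : uniq [seq v <- axes | axis_count v == k].
  by rewrite filter_uniq ?axes_uniq.
move: [seq v <- _ | _] sV UV => V sV UV.
have ULV : uniq (lines n V).
  by apply: lines_uniq => // v; rewrite sV => /andP[].
rewrite -(size_lines V n1) -(card_uniqP ULV) -cardsE /orth_mult.
congr #|pred_of_set _|; apply/setP => a; rewrite !in_set.
apply/idP/idP => [/eqP mu_a|/linesP[v [t [Vv t0 ->]]]]; last first.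
  by move: Vv; rewrite sV => /andP[/eqP <- Dv]; rewrite orth_count_axis.
have a0 : a != 0.
  by apply: contraTneq Sk => a0; rewrite -mu_a a0 orth_count0.
have mu2 : (1 < orth_count a)%N by rewrite mu_a; case: (k) Sk => [|[]].
have [v [t [Dv t0 Ea]]] := orth_count_ge2 n1 n_odd n3 mu2 a0.
apply/linesP; exists v, t; split=> //; rewrite sV Dv andbT.
by rewrite -mu_a Ea orth_count_axis.
Qed.

(** A nonzero vector of count 13 would lie on the line of an axis, where the count is at most 4. *)
Lemma orth_mult13 (n : nat) :
  (1 < n)%N -> odd n -> ~~ (3 %| n)%N -> orth_mult n 13 = 1%N.
Proof.
move=> n1 n_odd n3; transitivity #|[set (0 : 'rV['Z_n]_3)]|; last exact: cards1.
congr #|pred_of_set _|.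
apply/setP=> a; rewrite in_set in_set1.
apply/eqP/eqP => [mu_a|->]; last by rewrite orth_count0.
apply/eqP; apply: contraT => a0.
have mu2 : (1 < orth_count a)%N by rewrite mu_a.
have [v [t [Dv t0 Ea]]] := orth_count_ge2 n1 n_odd n3 mu2 a0.
have := allP axis_count_values v Dv.
by rewrite -(orth_count_axis n1 n_odd n3 Dv t0) -Ea mu_a.
Qed.

(** Used with f the identity for the total of the counts, which yields M_1, and with f constantly 1
    for the number of vectors, which yields M_0. *)
Lemma sum_orth_mult (n : nat) (f : nat -> nat) :
  (1 < n)%N -> odd n -> ~~ (3 %| n)%N ->
  (\sum_(a : 'rV['Z_n]_3) f (orth_count a) =
   \sum_(k <- orth_values) f k * orth_mult n k)%N.
Proof.
move=> n1 n_odd n3.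
transitivity (\sum_(a : 'rV['Z_n]_3)
  \sum_(k <- orth_values | k == orth_count a) f k)%N.
  apply: eq_bigr => a _; rewrite -big_filter.
  by rewrite filter_pred1_uniq // ?orth_count_range // big_seq1.
rewrite (exchange_big_dep xpredT) //=; apply: eq_bigr => k _.
rewrite sum_nat_const mulnC; congr (_ * _)%N.
by apply: eq_card => a; rewrite !inE eq_sym.
Qed.

Lemma card_torus (n : nat) : (1 < n)%N -> #|{: 'rV['Z_n]_3}| = (n ^ 3)%N.
Proof. by move=> n1; rewrite card_mx card_ord Zp_cast. Qed.

(** * Characteristic polynomial, eigenspaces and trace of a diagonalised matrix *)

Lemma mxrank_diag (F : fieldType) (m : nat) (d : 'rV[F]_m) :
  \rank (diag_mx d) = #|[set i | d 0 i != 0]|.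
Proof.
(* The row space is the direct sum of the coordinate lines at the nonzero diagonal entries. *)
have E : (diag_mx d :=: \sum_(i | d 0 i != 0) <<delta_mx 0 i : 'rV[F]_m>>)%MS.
  apply/eqmxP/andP; split.
    apply/row_subP => i; rewrite row_diag_mx; have [->|di0] := eqVneq (d 0 i) 0.
      by rewrite scale0r sub0mx.
    by rewrite scalemx_sub // (sumsmx_sup i) ?genmxE.
  apply/sumsmx_subP => i di0; rewrite genmxE.
  by rewrite -(eqmx_scale _ di0) -row_diag_mx row_sub.
rewrite E (mxdirectP _) /=; last first.
  by exact: (@mxdirect_delta _ _ _ _ id).
by under eq_bigr do rewrite mxrank_gen mxrank_delta; rewrite sum1_card cardsE.
Qed.

Section Diagonalised.
Variables (F : fieldType) (m : nat) (A P : 'M[F]_m) (d : 'rV[F]_m).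
Hypotheses (P_unit : P \in unitmx) (PA : P *m A = diag_mx d *m P).

(** With D the diagonal matrix, P (X - A) = (X - D) P over the polynomial ring; taking determinants,
    the nonzero det P cancels. *)
Lemma char_poly_diagonalised : char_poly A = \prod_i ('X - (d 0 i)%:P).
Proof.
have -> : \prod_i ('X - (d 0 i)%:P) = char_poly (diag_mx d).
  rewrite char_poly_trig ?diag_mx_is_trig //.
  by apply: eq_bigr => i _; rewrite mxE eqxx.
pose Q := map_mx polyC P.
have detQ : \det Q != 0.
  by rewrite det_map_mx polyC_eq0 -unitfE -unitmxE.
apply: (mulfI detQ); rewrite [RHS]mulrC -!det_mulmx; congr (\det _).
rewrite mulmxBr mulmxBl -!map_mxM PA; congr (_ - _).
by rewrite scalar_mxC.
Qed.

Lemma mxrank_eigenspace_diagonalised (l : F) :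
  \rank (eigenspace A l) = #|[set i | d 0 i == l]|.
Proof.
(* Left multiplication by P preserves the rank of A - l and gives (D - l) P; the transposes turn it
   into a right multiplication, as [mxrankMfree] expects. *)
rewrite mxrank_ker -(mxrank_tr (A - _)) -(mxrankMfree _ (_ : row_free P^T)).
  rewrite -trmx_mul mxrank_tr mulmxBr PA scalar_mxC -mulmxBl.
  rewrite mxrankMfree ?row_free_unit //.
  rewrite -diag_const_mx -raddfB mxrank_diag /=.
  have -> : [set i | (d - const_mx l) 0 i != 0] = ~: [set i | d 0 i == l].
    by apply/setP=> i; rewrite !inE !mxE subr_eq0.
  by rewrite cardsCs setCK card_ord subKn // -[leqRHS]card_ord max_card.
by rewrite row_free_unit unitmx_tr.
Qed.

Lemma mxtrace_diagonalised : \tr A = \sum_i d 0 i.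
Proof. by rewrite -[A](mulKmx P_unit) PA mxtrace_mulC mulmxK // mxtrace_diag. Qed.

End Diagonalised.

(** * Characters of the torus and Fourier diagonalisation of the adjacency matrix *)

Lemma reindex_enum_val (S : Type) (idx : S) (op : Monoid.com_law idx)
    (T : finType) (f : T -> S) :
  \big[op/idx]_(i < #|{: T}|) f (enum_val i) = \big[op/idx]_x f x.
Proof. by rewrite [RHS](reindex _ (onW_bij _ (@enum_val_bij T))). Qed.

(** Translation by x0 permutes the terms and multiplies the sum by f x0, which differs from 1. *)
Lemma sum_char_eq0 (F : idomainType) (G : finZmodType) (f : G -> F) (x0 : G) :
  {morph f : x y / x + y >-> x * y} -> f x0 != 1 -> \sum_x f x = 0.
Proof.
move=> fM f1; have : (f x0 - 1) * \sum_x f x = 0.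
  rewrite mulrBl mul1r; apply/eqP; rewrite subr_eq0 eq_sym mulr_sumr.
  by rewrite (reindex_inj (addrI x0)) /=; apply/eqP; apply: eq_bigr => x _.
by move/eqP; rewrite mulf_eq0 subr_eq0 (negbTE f1) => /eqP.
Qed.

Section Characters.
Variables (n : nat) (F : numFieldType) (z : F).
Hypotheses (n_gt1 : (1 < n)%N) (n_odd : odd n) (n_not3 : ~~ (3 %| n)%N).
Hypothesis z_prim : n.-primitive_root z.

(** The exponent is the residue a.x coerced to its representative below n; since z has order n, the
    result is additive in a and in x. *)
Definition chi (a x : 'rV['Z_n]_3) : F := z ^+ (a *m x^T) 0 0.

Lemma exprZpD (c c' : 'Z_n) : z ^+ (c + c')%R = z ^+ c * z ^+ c'.
Proof.
rewrite -exprD -(prim_expr_mod z_prim (c + c')%N).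
by rewrite /= [X in (_ %% X)%N]Zp_cast.
Qed.

Lemma exprZp_eq1 (c : 'Z_n) : (z ^+ c == 1) = (c == 0).
Proof.
rewrite -(prim_order_dvd z_prim).
have lt_cn : (c < n)%N by rewrite -{2}(Zp_cast n_gt1).
by rewrite /dvdn modn_small.
Qed.

Lemma chiDr (a x y : 'rV['Z_n]_3) : chi a (x + y) = chi a x * chi a y.
Proof. by rewrite /chi linearD /= mulmxDr mxE exprZpD. Qed.

Lemma chiDl (a b x : 'rV['Z_n]_3) : chi (a + b) x = chi a x * chi b x.
Proof. by rewrite /chi mulmxDl mxE exprZpD. Qed.

Lemma chi_tvec (a : 'rV['Z_n]_3) (t : 'Z_n) (v : ivec) :
  chi a (t *: tvec n v) = z ^+ (t * dot a (vec v))%R.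
Proof.
rewrite /chi (_ : (_ *m _) 0 0 = t * dot a (vec v)) //.
rewrite linearZ /= -scalemxAr !mxE; congr (_ * _).
by apply: eq_bigr => i _; rewrite !mxE.
Qed.

(** If a has a nonzero coordinate i, its character is nontrivial at the i-th basis vector. *)
Lemma sum_chi (a : 'rV['Z_n]_3) :
  \sum_x chi a x = if a == 0 then (#|{: 'rV['Z_n]_3}|)%:R else 0.
Proof.
have [->|/rV0Pn[i ai0]] := eqVneq a 0.
  under eq_bigr do rewrite /chi mul0mx mxE expr0.
  by rewrite sumr_const.
apply: (@sum_char_eq0 _ _ _ (delta_mx 0 i)) => [x y|]; first exact: chiDr.
rewrite /chi trmx_delta -colE mxE exprZp_eq1.
by rewrite ai0.
Qed.

(** The sum over all t is n or 0; the -1 removes the term t = 0. *)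
Lemma sum_exprZp (c : 'Z_n) :
  \sum_(t : 'Z_n | t != 0) z ^+ (t * c)%R = (if c == 0 then n%:R else 0) - 1.
Proof.
apply/eqP; rewrite eq_sym subr_eq addrC; apply/eqP.
rewrite -[X in X + _](_ : z ^+ (0 * c : 'Z_n)%R = 1); last first.
  by rewrite mul0r expr0.
rewrite -(@bigD1 _ _ _ _ (0 : 'Z_n) predT (fun t : 'Z_n => z ^+ (t * c)%R)) //.
have [->|c0] := eqVneq c 0.
  under eq_bigr do rewrite mulr0 expr0.
  by rewrite sumr_const card_ord Zp_cast.
apply/esym/(@sum_char_eq0 _ _ _ 1) => [x y|]; first by rewrite mulrDl exprZpD.
by rewrite mul1r exprZp_eq1.
Qed.

(** Exhibits the queen graph as a Cayley graph of the torus, whose connection set is the union of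
    the punctured lines of the directions. *)
Lemma queen_adjE (x y : 'rV['Z_n]_3) :
  queen_adj x y = (y - x \in lines n dirs).
Proof.
apply/idP/linesP => [/andP[_ /hasP[u]]|[v [t [Dv t0 Et]]]].
  rewrite queen_dirsE => /mapP[v Dv ->] /existsP[t /andP[t_gt0 /eqP ->]].
  exists v, t%:R; split=> //; last by rewrite addrC addKr.
  apply: contraTneq t_gt0 => /(congr1 val) /=.
  by rewrite val_Zp_nat // modn_small // => ->.
have lt_tn : (t < n)%N by rewrite -{2}(Zp_cast n_gt1).
apply/andP; split.
  apply/eqP=> Exy.
  have Ax : v \in axes by rewrite mem_cat Dv.
  (* If x = y then t v = 0 v, and injectivity along an axis gives t = 0. *)
  have E : t *: tvec n v = 0 *: tvec n v by rewrite scale0r -Et Exy subrr.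
  by have [_ t00] := axis_inj n_gt1 n_odd n_not3 Ax Ax t0 E;
    rewrite t00 eqxx in t0.
apply/hasP; exists (vec v); first by rewrite queen_dirsE map_f.
apply/existsP; exists (Ordinal lt_tn) => /=.
by rewrite lt0n t0 /= natr_Zp -[map_mx _ _]/(tvec n v) -Et addrC subrK.
Qed.

Definition dft : 'M[F]_#|{: 'rV['Z_n]_3}| :=
  \matrix_(i, j) chi (enum_val i) (enum_val j).

Lemma dft_unit : dft \in unitmx.
Proof.
pose N : F := #|{: 'rV['Z_n]_3}|%:R.
have N0 : N != 0 by rewrite pnatr_eq0 -lt0n; apply/card_gt0P; exists 0.
(* The inverse Fourier transform: characters of opposite vectors, divided by the number of
   vertices. *)
pose Q := \matrix_(i < #|{: 'rV['Z_n]_3}|, j < #|{: 'rV['Z_n]_3}|)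
  (N^-1 * chi (- enum_val j) (enum_val i)).
suff /mulmx1_unit[] : dft *m Q = 1%:M by [].
apply/matrixP => i j; rewrite !mxE.
under eq_bigr do rewrite !mxE mulrCA -chiDl.
rewrite -mulr_sumr (@reindex_enum_val _ _ _ _ (chi _)) sum_chi.
rewrite subr_eq0 (inj_eq enum_val_inj).
by case: eqP => _; rewrite ?mulr0 // mulVf.
Qed.

Definition queen_spec : 'rV[F]_#|{: 'rV['Z_n]_3}| :=
  \row_i queen_eig F n (orth_count (enum_val i)).

(** Each direction contributes n - 1 if orthogonal to a and -1 otherwise. The sign in the argument
    comes from the convolution in [dft_queen] and disappears under t -> -t. *)
Lemma sum_lines_chi (a : 'rV['Z_n]_3) :
  \sum_(x <- lines n dirs) chi a (- x) = queen_eig F n (orth_count a).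
Proof.
rewrite big_allpairs_dep /=.
transitivity (\sum_(v <- dirs) ((if dot a (vec v) == 0 then n%:R else 0) - 1 : F)).
  apply: eq_bigr => v _; rewrite big_filter big_enum_cond /= -sum_exprZp.
  rewrite (reindex_inj oppr_inj); apply: eq_big => [t|t _].
    by rewrite oppr_eq0.
  by rewrite scaleNr opprK chi_tvec.
rewrite sumrB -big_mkcond !big_const_seq !iter_addr_0 count_predT.
by rewrite /queen_eig /orth_count queen_dirsE count_map mulnC natrM mulr_natr.
Qed.

(** Characters are eigenvectors of a Cayley graph: substituting y - x for x factors out [chi a y]
    and leaves a sum over the connection set. *)
Lemma dft_queen : dft *m queen_mx F n = diag_mx queen_spec *m dft.
Proof.
apply/matrixP => i j; rewrite mul_diag_mx !mxE.
under eq_bigr do rewrite !mxE queen_adjE.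
rewrite (@reindex_enum_val _ _ _ _
  (fun x => chi (enum_val i) x * (enum_val j - x \in lines n dirs)%:R)).
set a := enum_val i; set y := enum_val j.
have UL : uniq (lines n dirs).
  by apply: lines_uniq => // v Dv; rewrite mem_cat Dv.
rewrite -sum_lines_chi mulr_suml.
transitivity (\sum_(x | x \in lines n dirs) chi a (y - x)).
  rewrite (reindex_inj (inv_inj (subKr y))) /=.
  rewrite [RHS]big_mkcond /=; apply: eq_bigr => x _.
  by rewrite subKr; case: (x \in _); rewrite ?mulr1 ?mulr0.
rewrite -big_uniq //. apply: eq_bigr => x _.
by rewrite chiDr mulrC.
Qed.

End Characters.

(** * Change of coefficient ring and the spectrum of the queen graph *)

Lemma map_queen_mx (R S : pzRingType) (f : {rmorphism R -> S}) (n : nat) :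
  map_mx f (queen_mx R n) = queen_mx S n.
Proof. by apply/matrixP => i j; rewrite !mxE rmorph_nat. Qed.

Lemma rmorph_queen_eig (R S : pzRingType) (f : {rmorphism R -> S}) (n k : nat) :
  f (queen_eig R n k) = queen_eig S n k.
Proof. by rewrite rmorphB !rmorph_nat. Qed.

Lemma queen_eig_eq (R : numDomainType) (n k l : nat) : (0 < n)%N ->
  (queen_eig R n k == queen_eig R n l) = (k == l).
Proof.
by move=> n0; rewrite (inj_eq (addIr _)) eqr_nat eqn_pmul2r.
Qed.

Section Spectrum.
Variable n : nat.
Hypotheses (n_gt1 : (1 < n)%N) (n_odd : odd n) (n_not3 : ~~ (3 %| n)%N).

(* Computed over algC, where the characters live, hence over int. *)
Lemma char_poly_queen (R : comNzRingType) :
  char_poly (queen_mx R n) =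
  \prod_(a : 'rV['Z_n]_3) ('X - (queen_eig R n (orth_count a))%:P).
Proof.
pose p (S : comNzRingType) : {poly S} :=
  \prod_(a : 'rV['Z_n]_3) ('X - (queen_eig S n (orth_count a))%:P).
have map_p (S T : comNzRingType) (f : {rmorphism S -> T}) : map_poly f (p S) = p T.
  rewrite rmorph_prod; apply: eq_bigr => a _.
  by rewrite rmorphB /= map_polyX map_polyC /= rmorph_queen_eig.
have EC : char_poly (queen_mx algC n) = p algC.
  have [z z_prim] := C_prim_root_exists (ltnW n_gt1).
  have QD := dft_queen n_gt1 n_odd n_not3 z_prim.
  rewrite (char_poly_diagonalised (dft_unit n_gt1 z_prim) QD).
  under eq_bigr do rewrite mxE.
  exact: (reindex_enum_val _ (fun a => 'X - (queen_eig algC n (orth_count a))%:P)).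
have EZ : char_poly (queen_mx int n) = p int.
  apply: (map_inj_poly (f := intr : int -> algC)) => //; first exact: intr_inj.
  by rewrite map_p map_char_poly map_queen_mx.
by rewrite -(map_queen_mx intr) -map_char_poly EZ map_p.
Qed.

(** Rank is invariant under field extension, so the rank over R equals that over [rat], hence that
    over [algC], where the characters diagonalise. *)
Lemma mxrank_eigenspace_queen (R : numFieldType) (k : nat) :
  \rank (eigenspace (queen_mx R n) (queen_eig R n k)) = orth_mult n k.
Proof.
have rank_rat (S : numFieldType) :
    \rank (eigenspace (queen_mx S n) (queen_eig S n k)) =
    \rank (eigenspace (queen_mx rat n) (queen_eig rat n k)).
  rewrite -(map_queen_mx (ratr : {rmorphism rat -> S})).
  by rewrite -(rmorph_queen_eig (ratr : {rmorphism rat -> S}))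
    -map_eigenspace mxrank_map.
rewrite rank_rat -(rank_rat algC).
have [z z_prim] := C_prim_root_exists (ltnW n_gt1).
have QD := dft_queen n_gt1 n_odd n_not3 z_prim.
rewrite (mxrank_eigenspace_diagonalised (dft_unit n_gt1 z_prim) QD).
rewrite -!sum1dep_card /orth_mult -sum1dep_card big_mkcond [RHS]big_mkcond /=.
under eq_bigr do rewrite mxE queen_eig_eq ?(ltnW n_gt1) //.
exact: (reindex_enum_val _ (fun a => if orth_count a == k then 1%N else 0%N)).
Qed.

Lemma mup_char_poly_queen (R : numFieldType) (k : nat) :
  mup (queen_eig R n k) (char_poly (queen_mx R n)) = orth_mult n k.
Proof.
rewrite char_poly_queen.
rewrite -(big_map (fun a : 'rV['Z_n]_3 => queen_eig R n (orth_count a)) predT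
  (fun l => 'X - l%:P)) mu_prod_XsubC count_map.
rewrite -sum1_count /orth_mult -sum1dep_card.
by apply: eq_bigl => a; rewrite /= queen_eig_eq // ltnW.
Qed.

Lemma eigenvalue_queen (R : numFieldType) (l : R) :
  eigenvalue (queen_mx R n) l <->
  exists k : nat, [/\ k \in orth_values, (0 < orth_mult n k)%N & l = queen_eig R n k].
Proof.
split=> [|[k [_ mult_k ->]]]; last first.
  by rewrite /eigenvalue -mxrank_eq0 mxrank_eigenspace_queen -lt0n.
rewrite eigenvalue_root_char char_poly_queen rootE horner_prod prodf_seq_eq0.
case/hasP=> a _ /=; rewrite hornerXsubC subr_eq0 => /eqP ->.
exists (orth_count a); split=> //; first exact: orth_count_range.
by apply/card_gt0P; exists a; rewrite inE.
Qed.

(** * The trace identity and the multiplicities of 1 and 0 *)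

Lemma sum_orth_count : (\sum_(a : 'rV['Z_n]_3) orth_count a = 13 * n ^ 2)%N.
Proof.
have n0 : (0 < n)%N by rewrite ltnW.
have [z z_prim] := C_prim_root_exists n0.
have QD := dft_queen n_gt1 n_odd n_not3 z_prim.
have := mxtrace_diagonalised (dft_unit n_gt1 z_prim) QD.
(* The zero diagonal makes the trace 0, so the n^3 eigenvalues n mu(a) - 13 sum to 0; one factor n
   is cancelled at the end. *)
rewrite /mxtrace big1 => [|i _]; last by rewrite mxE queen_adj_irr.
under eq_bigr do rewrite mxE.
rewrite (reindex_enum_val _ (fun a => queen_eig algC n (orth_count a))).
rewrite sumrB sumr_const card_torus // -natr_sum -mulrnA => /esym/eqP.
rewrite subr_eq0 eqr_nat -big_distrl /= => /eqP E.
by apply/eqP; rewrite -(eqn_pmul2r n0) E; apply/eqP; ring.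
Qed.


(** The 9 axes with a zero entry have four orthogonal directions, the 4 with all entries 1 or -1
    have three, and the 12 with an entry 2 or -2 have two. *)
Lemma orth_mult_cases : [/\ orth_mult n 13 = 1, orth_mult n 4 = 9 * n.-1,
  orth_mult n 3 = 4 * n.-1 & orth_mult n 2 = 12 * n.-1]%N.
Proof.
by rewrite orth_mult13 // !orth_mult_axes //; split; congr (_ * _)%N; vm_compute.
Qed.

(** Vectors of count 0 add nothing to the total 13 n^2, which leaves M_1 as the only unknown. *)
Lemma orth_mult1 : (orth_mult n 1)%:Z = 13 * n%:Z ^+ 2 - 72 * n%:Z + 59.
Proof.
have [E13 E4 E3 E2] := orth_mult_cases.
have := sum_orth_mult id n_gt1 n_odd n_not3; rewrite sum_orth_count.
rewrite /orth_values !big_cons big_nil E13 E4 E3 E2 /=; nia.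
Qed.

Lemma orth_mult0 :
  (orth_mult n 0)%:Z = n%:Z ^+ 3 - 13 * n%:Z ^+ 2 + 47 * n%:Z - 35.
Proof.
have [E13 E4 E3 E2] := orth_mult_cases; have E1 := orth_mult1.
have := sum_orth_mult (fun=> 1%N) n_gt1 n_odd n_not3.
rewrite sum1_card card_torus //.
rewrite /orth_values !big_cons big_nil E13 E4 E3 E2 /=; nia.
Qed.

(** This form shows the vanishing at 5 and 7 and the positivity beyond 7. *)
Lemma orth_mult0_factor :
  (orth_mult n 0)%:Z = (n%:Z - 1) * (n%:Z - 5) * (n%:Z - 7).
Proof. by rewrite orth_mult0; ring. Qed.

End Spectrum.

Theorem theorem4p2 (n : nat) (n_ge5 : (5 <= n)%N) (n_odd : odd n)
    (n_not3 : ~~ (3 %| n)%N) :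
  (forall a : 'rV['Z_n]_3, orth_count a \in orth_values) /\
  [/\ (orth_mult n 13)%:Z = 1,
      (orth_mult n 4)%:Z = 9 * (n%:Z - 1),
      (orth_mult n 3)%:Z = 4 * (n%:Z - 1),
      (orth_mult n 2)%:Z = 12 * (n%:Z - 1) &
      (orth_mult n 1)%:Z = 13 * n%:Z ^+ 2 - 72 * n%:Z + 59 /\
      (orth_mult n 0)%:Z = n%:Z ^+ 3 - 13 * n%:Z ^+ 2 + 47 * n%:Z - 35] /\
  (forall R : numFieldType,
     (forall l : R, eigenvalue (queen_mx R n) l <->
        exists k : nat, [/\ k \in orth_values, (0 < orth_mult n k)%N
                          & l = queen_eig R n k]) /\
     (forall k : nat, k \in orth_values ->
        mup (queen_eig R n k) (char_poly (queen_mx R n)) = orth_mult n k /\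
        \rank (eigenspace (queen_mx R n) (queen_eig R n k)) = orth_mult n k)) /\
  (n = 5%N \/ n = 7%N -> orth_mult n 0 = 0%N) /\
  ((7 < n)%N -> forall k : nat, k \in orth_values -> (0 < orth_mult n k)%N).
Proof.
have n_gt1 : (1 < n)%N by apply: leq_trans n_ge5.
have [E13 E4 E3 E2] := orth_mult_cases n_gt1 n_odd n_not3.
have E1 := orth_mult1 n_gt1 n_odd n_not3.
have E0 := orth_mult0 n_gt1 n_odd n_not3.
have F0 := orth_mult0_factor n_gt1 n_odd n_not3.
split; first by move=> a; apply: orth_count_range.
split; first by rewrite E13 E4 E3 E2; split=> //; lia.
split.
  move=> R; split=> [l|k _]; first exact: eigenvalue_queen.
  by rewrite mup_char_poly_queen // mxrank_eigenspace_queen.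
split=> [[] En|n_gt7 k].
(* Only the three factors are rewritten, so that [orth_mult n 0] stays the same term in hypothesis
   and goal. *)
- by move: F0; rewrite {2 3 4}En; lia.
- by move: F0; rewrite {2 3 4}En; lia.
rewrite !inE => /or4P[||| /or3P[]] /eqP->.
- by rewrite -ltz_nat F0 !mulr_gt0 //; lia.
(* Positive because 13 n^2 - 72 n + 59 = (n - 1)(13 n - 59). *)
- by rewrite -ltz_nat E1; nia.
all: by rewrite ?E13 ?E4 ?E3 ?E2 //; lia.
Qed.
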